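(* Let $K$ be a field and let $\mathcal C$ be a $K$-linear Krull-Schmidt triangulated category with shift $[1]$ and with $\dim_K\mathrm{Hom}_{\mathcal C}(X,Y)<\infty$ for all $X,Y\in\mathcal C$. Let $\mathcal T$ be a cluster tilting subcategory of $\mathcal C$, and let $\psi:K_0(\mathcal C,0)\to K_0(\mathcal C)$ be the canonical epimorphism. Suppose that $\mathrm{Ker}(\psi)$ is generated by the elements $[\delta]=[X]+[Z]-[Y]$ in $K_0(\mathcal C,0)$, where $\delta: X\xrightarrow{f}Y\xrightarrow{g}Z\to X[1]$ runs through all Auslander-Reiten triangles in $\mathcal C$. Then $\mathcal C$ is locally finite. In particular, if $\mathcal T=\mathrm{add}\,T$ for a cluster tilting object $T$ in $\mathcal C$, then $|\mathrm{Ind}(\mathcal C)|<\infty$.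
   Context: Standing assumption: not all objects of $\mathcal C$ are projective and injective in the extriangulated sense, i.e. $\mathcal C$ is nonzero. All subcategories are full additive subcategories closed under isomorphisms. $\mathrm{Ind}(\mathcal C)$ is the set of isomorphism classes of indecomposable objects of $\mathcal C$. $\mathcal C$ is locally finite if for every $A\in\mathrm{Ind}(\mathcal C)$ there are only finitely many $B\in\mathrm{Ind}(\mathcal C)$ with $\mathrm{Hom}_{\mathcal C}(A,B)\neq0$ and only finitely many $B\in\mathrm{Ind}(\mathcal C)$ with $\mathrm{Hom}_{\mathcal C}(B,A)\neq0$. A subcategory $\mathcal T\subset\mathcal C$ closed under finite direct sums and direct summands is a cluster tilting subcategory if (1) $\mathcal T$ is functorially finite in $\mathcal C$, i.e. every $B\in\mathcal C$ admits a right $\mathcal T$-approximation (a morphism $T_B\to B$ with $T_B\in\mathcal T$ through which every morphism from an object of $\mathcal T$ to $B$ factors) and, dually, a left $\mathcal T$-approximation; and (2) $\mathcal T=\{X\in\mathcal C\mid \mathrm{Hom}_{\mathcal C}(\mathcal T,X[1])=0\}=\{X\in\mathcal C\mid\mathrm{Hom}_{\mathcal C}(X,\mathcal T[1])=0\}$. An object $T$ is a cluster tilting object if $\mathrm{add}(T)$ (direct summands of finite direct sums of copies of $T$) is a cluster tilting subcategory. An Auslander-Reiten triangle is a triangle $X\to Y\to Z\xrightarrow{h}X[1]$ with $h\neq0$ such that $a[1]\circ h=0$ for every $a:X\to X'$ that is not a section (split monomorphism) and $h\circ c=0$ for every $c:Z'\to Z$ that is not a retraction (split epimorphism). (Then $X$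 and $Z$ are indecomposable.) Grothendieck groups. Let $F$ be the free abelian group on the set of isomorphism classes $[X]$ of objects of $\mathcal C$. $K_0(\mathcal C,0)$ is the quotient of $F$ by the subgroup generated by all $[A]+[B]-[A\oplus B]$ (it is free abelian on $\mathrm{Ind}(\mathcal C)$). $K_0(\mathcal C)$ is the quotient of $K_0(\mathcal C,0)$ by the subgroup generated by all $[X]+[Z]-[Y]$ with $X\to Y\to Z\to X[1]$ a triangle in $\mathcal C$. *)

(* Defs.v *)
From HB Require Import structures.
From mathcomp Require Import all_boot all_algebra.
From mathcomp Require Import generic_quotient ring_quotient.
From mathcomp Require Import boolp classical_sets cardinality.
From mathcomp Require Import freeg.

Set Implicit Arguments.
Unset Strict Implicit.
Unset Printing Implicit Defensive.

Import GRing.Theory.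

Local Open Scope quotient_scope.
Local Open Scope classical_set_scope.
Local Open Scope ring_scope.

(** Hom-finiteness is built in: [vectType K] is the type of finite-dimensional
    K-vector spaces. *)

Record klinCat (K : fieldType) := KLinCat {
  obj :> Type;
  hom : obj -> obj -> vectType K;
  idm : forall X, hom X X;
  comp : forall X Y Z, hom Y Z -> hom X Y -> hom X Z;
  compA : forall W X Y Z (h : hom Y Z) (g : hom X Y) (f : hom W X),
    comp h (comp g f) = comp (comp h g) f;
  comp1m : forall X Y (f : hom X Y), comp (idm Y) f = f;
  compm1 : forall X Y (f : hom X Y), comp f (idm X) = f;
  comp_linear_r : forall X Y Z (g : hom Y Z), linear (fun f : hom X Y => comp g f);
  comp_linear_l : forall X Y Z (f : hom X Y), linear (fun g : hom Y Z => comp g f)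
}.

Arguments hom {K k} X Y.
Arguments idm {K k} X.
Arguments comp {K k X Y Z} g f.

Notation "g \oc f" := (comp g f) (at level 40, left associativity).

Section LinearCategories.
Variables (K : fieldType) (C : klinCat K).
Implicit Types X Y Z A B : C.

Definition is_iso X Y (f : hom X Y) : Prop :=
  exists g : hom Y X, g \oc f = idm X /\ f \oc g = idm Y.

Definition isomorphic X Y : Prop := exists f : hom X Y, is_iso f.

Definition is_section X Y (f : hom X Y) : Prop :=
  exists g : hom Y X, g \oc f = idm X.

Definition is_retraction X Y (f : hom X Y) : Prop :=
  exists g : hom Y X, f \oc g = idm Y.

Definition is_zero X : Prop := idm X = 0.

Definition is_sum2 A B X : Prop :=
  exists (i1 : hom A X) (i2 : hom B X) (p1 : hom X A) (p2 : hom X B),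
    [/\ p1 \oc i1 = idm A, p2 \oc i2 = idm B, p2 \oc i1 = 0, p1 \oc i2 = 0
      & i1 \oc p1 + i2 \oc p2 = idm X].

(** For n = 0 this says that X is a zero object. *)
Definition is_sum n (A : 'I_n -> C) X : Prop :=
  exists (i : forall k, hom (A k) X) (p : forall k, hom X (A k)),
    [/\ forall k, p k \oc i k = idm (A k),
        forall k l, k != l -> p l \oc i k = 0
      & \sum_k i k \oc p k = idm X].

Definition is_additive : Prop :=
  (exists X, is_zero X) /\ (forall A B, exists X, is_sum2 A B X).

Definition is_summand X Y : Prop := exists Z, is_sum2 X Z Y.

Definition indecomposable X : Prop :=
  ~ is_zero X /\ forall A B, is_sum2 A B X -> is_zero A \/ is_zero B.

(** Local ring: nonzero, with non-units closed under addition (stated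
    contrapositively). *)
Definition local_End X : Prop :=
  ~ is_zero X /\
  forall f g : hom X X, is_iso (f + g) -> is_iso f \/ is_iso g.

Definition krull_schmidt : Prop :=
  forall X, exists n (A : 'I_n -> C), (forall k, local_End (A k)) /\ is_sum A X.

(** Full additive subcategories closed under isomorphisms are identified with
    their sets of objects. *)
Definition subcategory (T : set C) : Prop :=
  [/\ forall X Y, isomorphic X Y -> T X -> T Y,
      forall X, is_zero X -> T X
    & forall A B X, is_sum2 A B X -> T A -> T B -> T X].

Definition summand_closed (T : set C) : Prop :=
  forall X Y, is_summand X Y -> T Y -> T X.

Definition right_approximation (T : set C) B TB (a : hom TB B) : Prop :=
  T TB /\ forall T' (f : hom T' B), T T' -> exists g : hom T' TB, a \oc g = f.

Definition left_approximation (T : set C) B TB (a : hom B TB) : Prop :=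
  T TB /\ forall T' (f : hom B T'), T T' -> exists g : hom TB T', g \oc a = f.

Definition functorially_finite (T : set C) : Prop :=
  forall B, (exists TB (a : hom TB B), right_approximation T a) /\
            (exists TB (a : hom B TB), left_approximation T a).

Definition add_closure (T : C) : set C :=
  [set X | exists n Y, is_sum (fun _ : 'I_n => T) Y /\ is_summand X Y].

Lemma is_iso_id X : is_iso (idm X).
Proof. by exists (idm X); rewrite !comp1m. Qed.

Lemma is_iso_comp X Y Z (g : hom Y Z) (f : hom X Y) :
  is_iso g -> is_iso f -> is_iso (g \oc f).
Proof.
move=> [g' [gK g'K]] [f' [fK f'K]]; exists (f' \oc g'); split.
- by rewrite compA -(compA f') gK compm1.
- by rewrite compA -(compA g) f'K compm1.
Qed.

Definition isob (X Y : {classic C}) : bool := `[< isomorphic X Y >].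

Lemma isob_refl : reflexive isob.
Proof. by move=> X; apply/asboolP; exists (idm (X : C)); exact: is_iso_id. Qed.

Lemma isob_sym : symmetric isob.
Proof.
by move=> X Y; apply/asboolP/asboolP => -[f [g [gf fg]]]; exists g, f.
Qed.

Lemma isob_trans : transitive isob.
Proof.
move=> Y X Z /asboolP[f f_iso] /asboolP[g g_iso].
by apply/asboolP; exists (g \oc f); exact: is_iso_comp.
Qed.

Canonical isob_equiv := EquivRel isob isob_refl isob_sym isob_trans.

Definition isoclass : choiceType := {eq_quot isob}.

Definition iso_class X : isoclass := \pi_({eq_quot isob}) (X : {classic C}).

Lemma iso_classP X Y : iso_class X = iso_class Y <-> isomorphic X Y.
Proof. by split=> [/eqmodP/asboolP|XY]; last exact/eqmodP/asboolP. Qed.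

Definition Ind : set isoclass := [set iso_class X | X in indecomposable].

Definition locally_finite : Prop :=
  forall A, indecomposable A ->
    finite_set [set iso_class B | B in
      [set B | indecomposable B /\ exists f : hom A B, f <> 0]] /\
    finite_set [set iso_class B | B in
      [set B | indecomposable B /\ exists f : hom B A, f <> 0]].

End LinearCategories.

Arguments Ind {K} C.

(** The shift is a K-linear autoequivalence, not required to be strictly
    invertible; [dist f g h] says that X -f-> Y -g-> Z -h-> X[1] is a
    distinguished triangle. *)

Record triCat (K : fieldType) := TriCat {
  tcat :> klinCat K;
  tcat_additive : is_additive tcat;

  shift : tcat -> tcat;
  shiftm : forall X Y : tcat, hom X Y -> hom (shift X) (shift Y);
  shiftm_linear : forall X Y, linear (@shiftm X Y);
  shiftm_id : forall X, shiftm (idm X) = idm (shift X);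
  shiftm_comp : forall X Y Z (g : hom Y Z) (f : hom X Y),
    shiftm (g \oc f) = shiftm g \oc shiftm f;
  shiftm_bij : forall X Y, bijective (@shiftm X Y);
  shift_esurj : forall Y, exists X, isomorphic (shift X) Y;

  dist : forall X Y Z : tcat, hom X Y -> hom Y Z -> hom Z (shift X) -> Prop;

  (* TR1 *)
  dist_iso : forall X Y Z (f : hom X Y) (g : hom Y Z) (h : hom Z (shift X))
      X' Y' Z' (f' : hom X' Y') (g' : hom Y' Z') (h' : hom Z' (shift X'))
      (u : hom X X') (v : hom Y Y') (w : hom Z Z'),
    is_iso u -> is_iso v -> is_iso w ->
    v \oc f = f' \oc u -> w \oc g = g' \oc v -> shiftm u \oc h = h' \oc w ->
    dist f g h -> dist f' g' h';
  dist_id : forall X N, is_zero N ->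
    dist (idm X) (0 : hom X N) (0 : hom N (shift X));
  dist_cone : forall X Y (f : hom X Y),
    exists Z (g : hom Y Z) (h : hom Z (shift X)), dist f g h;
  (* TR2 *)
  dist_rot : forall X Y Z (f : hom X Y) (g : hom Y Z) (h : hom Z (shift X)),
    dist f g h <-> dist g h (- shiftm f);
  (* TR3 *)
  dist_mor : forall X Y Z (f : hom X Y) (g : hom Y Z) (h : hom Z (shift X))
      X' Y' Z' (f' : hom X' Y') (g' : hom Y' Z') (h' : hom Z' (shift X'))
      (u : hom X X') (v : hom Y Y'),
    dist f g h -> dist f' g' h' -> v \oc f = f' \oc u ->
    exists w : hom Z Z', w \oc g = g' \oc v /\ shiftm u \oc h = h' \oc w;
  (* TR4, the octahedral axiom *)
  dist_oct : forall X Y Z X' Y' Z' (f : hom X Y) (g : hom Y Z)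
      (a : hom Y Z') (b : hom Z' (shift X))
      (c : hom Z X') (d : hom X' (shift Y))
      (e : hom Z Y') (k : hom Y' (shift X)),
    dist f a b -> dist g c d -> dist (g \oc f) e k ->
    exists (u : hom Z' Y') (v : hom Y' X'),
      [/\ dist u v (shiftm a \oc d),
          u \oc a = e \oc g, k \oc u = b, v \oc e = c & d \oc v = shiftm f \oc k]
}.

Arguments shift {K t} X.
Arguments shiftm {K t X Y} f.
Arguments dist {K t X Y Z} f g h.

Section TriangulatedCategories.
Variables (K : fieldType) (C : triCat K).
Implicit Types X Y Z : C.

Definition cluster_tilting (T : set C) : Prop :=
  [/\ subcategory T,
      summand_closed T,
      functorially_finite T,
      T = [set X | forall T' (f : hom T' (shift X)), T T' -> f = 0]
    & T = [set X | forall T' (f : hom X (shift T')), T T' -> f = 0]].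

Definition cluster_tilting_object (T : C) : Prop :=
  cluster_tilting (add_closure T).

Definition AR_triangle X Y Z (f : hom X Y) (g : hom Y Z) (h : hom Z (shift X)) :
    Prop :=
  [/\ dist f g h,
      h <> 0,
      forall X' (a : hom X X'), ~ is_section a -> shiftm a \oc h = 0
    & forall Z' (c : hom Z' Z), ~ is_retraction c -> h \oc c = 0].

End TriangulatedCategories.

(** Subgroups generated by a set, as decidable (by classical logic) predicates
    so that the library quotient [Quotient.quot] of a zmodType applies. *)

Section GeneratedSubgroup.
Variable V : zmodType.

Definition subgroup_gen (S : set V) : {pred V} :=
  fun x => `[< forall H : {pred V},
                 zmod_closed H -> (forall s, S s -> s \in H) -> x \in H >].

Lemma subgroup_gen_zmod_closed S : zmod_closed (subgroup_gen S).
Proof.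
split; first by apply/asboolP => H [].
move=> x y /asboolP xS /asboolP yS; apply/asboolP => H Hz SH.
by case: (Hz) => _; apply; [exact: xS | exact: yS].
Qed.

HB.instance Definition _ S :=
  GRing.isZmodClosed.Build V (subgroup_gen S) (subgroup_gen_zmod_closed S).

End GeneratedSubgroup.

Section GrothendieckGroups.
Variables (K : fieldType) (C : triCat K).

Definition free_iso : zmodType := {freeg (isoclass C) / int}.

Definition free_class (X : C) : free_iso := << iso_class X >>.

Definition split_relations : set free_iso :=
  [set r | exists A B X : C, is_sum2 A B X /\
     r = free_class A + free_class B - free_class X].

(** K_0(C, 0), the quotient of the free abelian group on isomorphism classes by
    split relations; K_0(C) is [K0] below. *)
Definition K0_split : zmodType := Quotient.quot (subgroup_gen split_relations).

Definition split_class (X : C) : K0_split :=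
  \pi_(Quotient.quot (subgroup_gen split_relations)) (free_class X).

Definition triangle_relations : set K0_split :=
  [set r | exists (X Y Z : C) (f : hom X Y) (g : hom Y Z) (h : hom Z (shift X)),
     dist f g h /\ r = split_class X + split_class Z - split_class Y].

Definition AR_relations : set K0_split :=
  [set r | exists (X Y Z : C) (f : hom X Y) (g : hom Y Z) (h : hom Z (shift X)),
     AR_triangle f g h /\ r = split_class X + split_class Z - split_class Y].

Definition K0 : zmodType := Quotient.quot (subgroup_gen triangle_relations).

Definition K0_proj : {additive K0_split -> K0} :=
  \pi_(Quotient.quot (subgroup_gen triangle_relations)).

End GrothendieckGroups.

Arguments AR_relations {K} C.

(* Main.v *)
Require Import Defs.
From HB Require Import structures.
From mathcomp Require Import all_boot all_algebra.
From mathcomp Require Import generic_quotient ring_quotient.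
From mathcomp Require Import boolp classical_sets cardinality.
From mathcomp Require Import freeg.

Set Implicit Arguments.
Unset Strict Implicit.
Unset Printing Implicit Defensive.

Import GRing.Theory Defs.

Local Open Scope quotient_scope.
Local Open Scope classical_set_scope.
Local Open Scope ring_scope.

(** The triangle A -> 0 -> A[1] puts [A] + [A[1]] in Ker(psi), so it is a
    finite integral combination of elements [delta] with delta an
    Auslander-Reiten triangle X -> Y -> Z.  For B indecomposable, Hom(B, -)
    maps delta to a short exact sequence unless B is isomorphic to Z or Z[-1].
    Hence dim Hom(B, A) + dim Hom(B, A[1]) vanishes for almost all B, and
    dually for Hom(-, B).  If T = add T0, any indecomposable X either satisfies
    Hom(T0, X) <> 0 or is isomorphic to X'[1] with X' in T, and then
    Hom(T0, X') <> 0. *)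

(** * Calculus of morphisms, zero objects and biproducts in a linear category *)

Section LinearCategory.
Variables (K : fieldType) (C : klinCat K).
Implicit Types X Y Z A B W N : C.

Lemma comp0m X Y Z (f : hom X Y) : (0 : hom Y Z) \oc f = 0.
Proof. by have := comp_linear_l f (-1) (0 : hom Y Z) 0; rewrite !scaleN1r !addNr. Qed.

Lemma compm0 X Y Z (g : hom Y Z) : g \oc (0 : hom X Y) = 0.
Proof. by have := comp_linear_r g (-1) (0 : hom X Y) 0; rewrite !scaleN1r !addNr. Qed.

Lemma compDl X Y Z (f : hom X Y) (g h : hom Y Z) :
  (g + h) \oc f = g \oc f + h \oc f.
Proof. by have := comp_linear_l f 1 g h; rewrite !scale1r. Qed.

Lemma compDr X Y Z (g : hom Y Z) (f h : hom X Y) :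
  g \oc (f + h) = g \oc f + g \oc h.
Proof. by have := comp_linear_r g 1 f h; rewrite !scale1r. Qed.

Lemma compNm X Y Z (g : hom Y Z) (f : hom X Y) : (- g) \oc f = - (g \oc f).
Proof. by apply/eqP; rewrite -addr_eq0 -compDl addNr comp0m. Qed.

Lemma compmN X Y Z (g : hom Y Z) (f : hom X Y) : g \oc (- f) = - (g \oc f).
Proof. by apply/eqP; rewrite -addr_eq0 -compDr addNr compm0. Qed.

Lemma comp_sumr (I : finType) X Y Z (g : hom Y Z) (f : I -> hom X Y) :
  g \oc (\sum_i f i) = \sum_i g \oc f i.
Proof.
exact: (big_morph (fun h => g \oc h) (compDr g) (compm0 X g)).
Qed.

Lemma hom_zero_dom N X (f : hom N X) : is_zero N -> f = 0.
Proof. by move=> N0; rewrite -[f]compm1 N0 compm0. Qed.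

Lemma hom_zero_cod N X (f : hom X N) : is_zero N -> f = 0.
Proof. by move=> N0; rewrite -[f]comp1m N0 comp0m. Qed.

Lemma isomorphic_sym X Y : isomorphic X Y -> isomorphic Y X.
Proof. by move=> [f [g [gf fg]]]; exists g, f. Qed.

Lemma isomorphic_sum2 X Y N : is_zero N -> isomorphic X Y -> is_sum2 X N Y.
Proof.
move=> N0 [f [g [gf fg]]]; exists f, 0, g, 0; split=> //.
- by rewrite comp0m N0.
- by rewrite comp0m.
- by rewrite compm0.
- by rewrite fg comp0m addr0.
Qed.

Lemma sum2_zeror X Y N : is_zero N -> is_sum2 X N Y -> isomorphic X Y.
Proof.
move=> N0 [i1 [i2 [p1 [p2 [e1 _ _ _ e]]]]]; exists i1, p1; split=> //.
by rewrite -e (hom_zero_dom i2) // comp0m addr0.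
Qed.

Lemma sum2_isomorphic A B X Y :
  is_sum2 A B X -> isomorphic X Y -> is_sum2 A B Y.
Proof.
move=> [i1 [i2 [p1 [p2 [e1 e2 e21 e12 e]]]]] [f [g [gf fg]]].
have cancel_gf U V (p : hom X V) (i : hom U X) :
    (p \oc g) \oc (f \oc i) = p \oc i.
  by rewrite compA -[p \oc g \oc f]compA gf compm1.
exists (f \oc i1), (f \oc i2), (p1 \oc g), (p2 \oc g).
rewrite !cancel_gf; split=> //.
by rewrite !compA -compDl -![f \oc _ \oc _]compA -compDr e compm1.
Qed.

Lemma zero_sum2 N : is_zero N -> is_sum2 N N N.
Proof.
by move=> N0; apply: isomorphic_sum2 => //; exists (idm N); exact: is_iso_id.
Qed.

End LinearCategory.

(** The elements satisfying [P] form a subgroup containing [S], and [subgroup_gen S] is the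
    intersection of all such subgroups. *)
Lemma subgroup_gen_ind (V : zmodType) (S : set V) (P : V -> Prop) :
  P 0 -> (forall x y, P x -> P y -> P (x - y)) -> (forall s, S s -> P s) ->
  forall x, x \in subgroup_gen S -> P x.
Proof.
move=> P0 PB PS x /asboolP/(_ (fun y => `[< P y >])) H.
apply/asboolP/H; first split; first exact/asboolP.
  by move=> y z /asboolP Py /asboolP Pz; apply/asboolP/PB.
by move=> s Ss; apply/asboolP/PS.
Qed.

Lemma subgroup_gen_mem (V : zmodType) (S : set V) s :
  S s -> s \in subgroup_gen S.
Proof. by move=> Ss; apply/asboolP => H _; apply. Qed.

(** * Short exact sequences and dimensions of Hom spaces *)

Section ExactSequence.
Variables (K : fieldType) (U V W : vectType K).

(** Rank-nullity for [g], whose kernel is the image of the injective [f]. The maps are plain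
    functions with linearity as a hypothesis, so that composition with a fixed morphism fits
    directly. *)
Lemma dimv_short_exact (f : U -> V) (g : V -> W) :
  linear f -> linear g -> (forall u, f u = 0 -> u = 0) ->
  (forall u, g (f u) = 0) -> (forall v, g v = 0 -> exists u, f u = v) ->
  (forall w, exists v, g v = w) ->
  dim V = (dim U + dim W)%N.
Proof.
move=> f_lin g_lin f_inj gf0 exact_mid g_surj.
pose fM := GRing.isLinear.Build _ _ _ _ f f_lin.
pose gM := GRing.isLinear.Build _ _ _ _ g g_lin.
pose f' : {linear U -> V} := HB.pack f fM.
pose g' : {linear V -> W} := HB.pack g gM.
have := limg_ker_dim (linfun g') fullv; rewrite capfv dimvf => <-.
have -> : limg (linfun g') = fullv.
  apply/eqP; rewrite eqEsubv subvf; apply/subvP => w _.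
  have [v <-] := g_surj w.
  by rewrite -[g v]/(g' v) -lfunE memv_img // memvf.
have -> : lker (linfun g') = limg (linfun f').
  apply/eqP; rewrite eqEsubv; apply/andP; split; apply/subvP => v.
    rewrite memv_ker lfunE => /eqP /exact_mid[u <-].
    by rewrite -[f u]/(f' u) -lfunE memv_img // memvf.
  case/memv_imgP => u _ ->; rewrite memv_ker !lfunE; apply/eqP; exact: gf0.
rewrite limg_dim_eq ?dimvf // capfv; apply/eqP; rewrite -subv0.
by apply/subvP => u; rewrite memv_ker lfunE memv0 => /eqP/f_inj ->.
Qed.

End ExactSequence.

Section HomDimension.
Variables (K : fieldType) (C : klinCat K).
Implicit Types X Y Z A B : C.

Definition hdim X Y : nat := dim (hom X Y).

Lemma hdim_eq0 X Y (f : hom X Y) : hdim X Y = 0%N -> f = 0.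
Proof.
move=> d0; apply/eqP; rewrite -memv0.
suff -> : 0%VS = fullv :> {vspace hom X Y} by rewrite memvf.
by apply/esym/eqP; rewrite -dimv_eq0 dimvf -[dim _]/(hdim X Y) d0.
Qed.

(** [Hom(B, -)] turns the biproduct into a short exact sequence with maps [i1] and [p2]. *)
Lemma hdim_sumr B X Y Z : is_sum2 X Y Z -> hdim B Z = (hdim B X + hdim B Y)%N.
Proof.
move=> [i1 [i2 [p1 [p2 [e1 e2 e21 e12 e]]]]].
apply: (dimv_short_exact (comp_linear_r i1) (comp_linear_r p2)) => /=.
- by move=> u u0; rewrite -[u]comp1m -e1 -compA u0 compm0.
- by move=> u; rewrite compA e21 comp0m.
- move=> v v0; exists (p1 \oc v).
  by rewrite -[RHS]comp1m -e compDl -[i2 \oc p2 \oc v]compA v0 compm0 addr0 compA.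
- by move=> w; exists (i2 \oc w); rewrite compA e2 comp1m.
Qed.

Lemma hdim_suml B X Y Z : is_sum2 X Y Z -> hdim Z B = (hdim X B + hdim Y B)%N.
Proof.
move=> [i1 [i2 [p1 [p2 [e1 e2 e21 e12 e]]]]].
apply: (dimv_short_exact (comp_linear_l p1) (comp_linear_l i2)) => /=.
- by move=> u u0; rewrite -[u]compm1 -e1 compA u0 comp0m.
- by move=> u; rewrite -compA e12 compm0.
- move=> v v0; exists (v \oc i1).
  by rewrite -[RHS]compm1 -e compDr [v \oc (i2 \oc p2)]compA v0 comp0m addr0 compA.
- by move=> w; exists (w \oc p2); rewrite -compA e2 compm1.
Qed.

End HomDimension.

(** * The shift functor and exactness of Hom on triangles *)

Section Triangulated.
Variables (K : fieldType) (C : triCat K).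
Implicit Types X Y Z A B W N : C.

Lemma shiftmD X Y (f g : hom X Y) : shiftm (f + g) = shiftm f + shiftm g.
Proof. by have := @shiftm_linear _ C X Y 1 f g; rewrite !scale1r. Qed.

Lemma shiftm0 X Y : shiftm (0 : hom X Y) = 0.
Proof.
by have := @shiftm_linear _ C X Y (-1) 0 0; rewrite !scaleN1r !addNr.
Qed.

Lemma shiftmN X Y (f : hom X Y) : shiftm (- f) = - shiftm f.
Proof. by apply/eqP; rewrite -addr_eq0 -shiftmD addNr shiftm0. Qed.

Lemma shiftm_inj X Y : injective (@shiftm K C X Y).
Proof. exact: bij_inj (@shiftm_bij _ C X Y). Qed.

Lemma shiftm_full X Y (g : hom (shift X) (shift Y)) :
  exists f : hom X Y, shiftm f = g.
Proof. by have [s _ sK] := @shiftm_bij _ C X Y; exists (s g). Qed.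

Lemma shift_zero X : is_zero X -> is_zero (shift X).
Proof. by rewrite /is_zero -shiftm_id => ->; rewrite shiftm0. Qed.

Lemma shift_zero_inv X : is_zero (shift X) -> is_zero X.
Proof. by rewrite /is_zero -shiftm_id -[0](shiftm0 X X) => /shiftm_inj. Qed.

Lemma shift_sum2 A B X : is_sum2 A B X -> is_sum2 (shift A) (shift B) (shift X).
Proof.
move=> [i1 [i2 [p1 [p2 [e1 e2 e21 e12 e]]]]].
exists (shiftm i1), (shiftm i2), (shiftm p1), (shiftm p2).
by rewrite -!shiftm_comp -shiftmD e1 e2 e21 e12 e !shiftm_id !shiftm0.
Qed.

Lemma shift_isomorphic X Y : isomorphic X Y -> isomorphic (shift X) (shift Y).
Proof.
move=> [f [g [gf fg]]]; exists (shiftm f), (shiftm g).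
by rewrite -!shiftm_comp gf fg !shiftm_id.
Qed.

Lemma shift_indecomposable_inv X Y :
  isomorphic (shift X) Y -> indecomposable Y -> indecomposable X.
Proof.
move=> XY [Y0 Yi]; split.
  move=> X0; apply: Y0; have [f [g [_ fg]]] := XY.
  rewrite /is_zero -fg.
  by rewrite (hom_zero_cod g (shift_zero X0)) compm0.
move=> A B /shift_sum2 AB.
have [/shift_zero_inv|/shift_zero_inv] := Yi _ _ (sum2_isomorphic AB XY).
  by left.
by right.
Qed.

(** TR3 extends [c] to a morphism from the rotated triangle [B -> 0 -> B[1]] to the rotation of the
    given one. Its third component [B[1] -> X[1]] is [d[1]] by fullness of the shift, and the two
    rotation signs cancel. *)
Lemma dist_hom_exact B X Y Z (f : hom X Y) (g : hom Y Z) (h : hom Z (shift X))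
    (c : hom B Y) :
  dist f g h -> g \oc c = 0 -> exists d : hom B X, f \oc d = c.
Proof.
move=> fgh gc0; have [[N N0] _] := tcat_additive C.
have /dist_rot idB := dist_id B N0.
have /dist_rot fgh' := fgh.
have [|w [_]] := dist_mor (u := c) (v := 0) idB fgh'.
  by rewrite comp0m gc0.
have [d <-] := shiftm_full w.
rewrite compmN compNm -!shiftm_comp compm1 => /oppr_inj/shiftm_inj ->.
by exists d.
Qed.

(** TR3 extends [c] to a morphism from the given triangle to [0 -> B -> B -> 0[1]]; its third
    component is [d]. *)
Lemma dist_cohom_exact B X Y Z (f : hom X Y) (g : hom Y Z) (h : hom Z (shift X))
    (c : hom Y B) :
  dist f g h -> c \oc f = 0 -> exists d : hom Z B, d \oc g = c.
Proof.
move=> fgh cf0; have [[N N0] _] := tcat_additive C.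
have idB : dist (0 : hom N B) (idm B) (0 : hom B (shift N)).
  by apply/dist_rot; rewrite shiftm0 oppr0; exact/dist_id/shift_zero.
have [|w [wg _]] := dist_mor (u := 0) (v := c) fgh idB.
  by rewrite cf0 comp0m.
by exists w; rewrite wg comp1m.
Qed.

Lemma dist_comp12 X Y Z (f : hom X Y) (g : hom Y Z) (h : hom Z (shift X)) :
  dist f g h -> g \oc f = 0.
Proof.
move=> fgh; have [[N N0] _] := tcat_additive C.
have [|w [<- _]] := dist_mor (u := idm X) (v := f) (dist_id X N0) fgh.
  by rewrite compm1.
by rewrite compm0.
Qed.

Lemma dist_comp23 X Y Z (f : hom X Y) (g : hom Y Z) (h : hom Z (shift X)) :
  dist f g h -> h \oc g = 0.
Proof. by move=> /dist_rot/dist_comp12. Qed.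

(** The complement is the cone of [s]. The connecting map [h] vanishes because [s[1]] is a split
    monomorphism; the second inclusion [t] arises by factoring [idm Y - s \oc r], which kills [s],
    through [g]. *)
Lemma section_sum2 X Y (s : hom X Y) : is_section s -> exists W, is_sum2 X W Y.
Proof.
move=> [r rs]; have [W [g [h sgh]]] := dist_cone s.
have h0 : h = 0.
  have /dist_rot/dist_comp23 := sgh; rewrite compNm => /eqP.
  rewrite oppr_eq0 => /eqP sh.
  by rewrite -[h]comp1m -shiftm_id -rs shiftm_comp -compA sh compm0.
have [|t tg] := dist_cohom_exact (c := idm Y - s \oc r) sgh.
  by rewrite compDl compNm comp1m -compA rs compm1 subrr.
(* Since h = 0, the map g is an epimorphism. *)
have epi V (k : hom W V) : k \oc g = 0 -> k = 0.
  have /dist_rot gh := sgh.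
  by move=> /(dist_cohom_exact gh)[d <-]; rewrite h0 compm0.
have gs := dist_comp12 sgh.
exists W, s, t, r, g; split=> //.
- apply/eqP; rewrite -subr_eq0; apply/eqP/epi.
  by rewrite compDl compNm -compA tg compDr compmN compA gs comp0m subr0 compm1
    comp1m subrr.
- apply: epi; rewrite -compA tg compDr compmN compA rs comp1m compm1.
  exact: subrr.
- by rewrite tg addrC subrK.
Qed.

(** Converts the section and retraction conditions on Auslander-Reiten triangles into conditions on
    isomorphism classes: the complement of [X] in [Y] must vanish. *)
Lemma indecomposable_section X Y (s : hom X Y) :
  is_section s -> ~ is_zero X -> indecomposable Y -> isomorphic X Y.
Proof.
move=> /section_sum2[W XWY] X0 [_ Yi].
by have [//|W0] := Yi _ _ XWY; exact: sum2_zeror XWY.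
Qed.

Lemma indecomposable_retraction X Y (r : hom X Y) :
  is_retraction r -> ~ is_zero Y -> indecomposable X -> isomorphic X Y.
Proof.
move=> [s rs] Y0 Xi; apply: isomorphic_sym.
by apply: (indecomposable_section (s := s)) => //; exists r.
Qed.

(** * Hom dimensions along an Auslander-Reiten triangle *)

Section AuslanderReiten.
Variables (X Y Z : C) (f : hom X Y) (g : hom Y Z) (h : hom Z (shift X)).
Hypothesis AR : AR_triangle f g h.

Lemma AR_dom_nonzero : ~ is_zero X.
Proof.
case: AR => _ h0 _ _ X0; apply: h0.
by apply: hom_zero_cod; exact: shift_zero.
Qed.

Lemma AR_cod_nonzero : ~ is_zero Z.
Proof. by case: AR => _ h0 _ _ Z0; apply: h0; exact: hom_zero_dom. Qed.

(** No map [B -> Z] is a retraction, so each is killed by [h] and lifts to [Y]. The kernel of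
    [Hom(B, X) -> Hom(B, Y)] comes from maps [B[1] -> Z] followed by [h], and these are not
    retractions either. [Z'] stands for [Z[-1]]. *)
Lemma AR_hdimr B Z' : indecomposable B -> isomorphic (shift Z') Z ->
  ~ isomorphic B Z -> ~ isomorphic B Z' ->
  hdim B Y = (hdim B X + hdim B Z)%N.
Proof.
move=> Bi [w [w' [w'w ww']]] BZ BZ'; have [fgh h0 _ hR] := AR.
have Z'0 : ~ is_zero Z'.
  move=> /shift_zero zZ'; apply: AR_cod_nonzero.
  by rewrite /is_zero -ww' (hom_zero_cod w') ?compm0.
apply: (dimv_short_exact (comp_linear_r f) (comp_linear_r g)) => /=.
- move=> c fc0; apply: shiftm_inj; rewrite shiftm0.
  have /dist_rot/dist_rot hfg := fgh.
  have [|d <-] := dist_hom_exact (c := shiftm c) hfg.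
    by rewrite compNm -shiftm_comp fc0 shiftm0 oppr0.
  (* If [d : B[1] -> Z] had a right inverse [s], then transport along [w] and unshifting would give
     a retraction [B -> Z']. *)
  apply: hR => -[s ds]; apply: BZ'.
  have [d' d'E] := shiftm_full (w' \oc d).
  have [s' s'E] := shiftm_full (s \oc w).
  apply: (indecomposable_retraction (r := d')) => //; exists s'.
  apply: shiftm_inj; rewrite shiftm_comp d'E s'E compA -[w' \oc d \oc s]compA.
  by rewrite ds compm1 w'w shiftm_id.
- by move=> c; rewrite compA (dist_comp12 fgh) comp0m.
- by move=> c; exact: dist_hom_exact fgh.
- move=> c; have /dist_rot ghf := fgh.
  apply: (dist_hom_exact ghf); apply: hR => cR; apply: BZ.
  by apply: (indecomposable_retraction cR) => //; exact: AR_cod_nonzero.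
Qed.

Lemma AR_hdiml B : indecomposable B ->
  ~ isomorphic B X -> ~ isomorphic B (shift X) ->
  hdim Y B = (hdim X B + hdim Z B)%N.
Proof.
move=> Bi BX BX1; have [fgh h0 hL _] := AR; rewrite addnC.
apply: (dimv_short_exact (comp_linear_l g) (comp_linear_l f)) => /=.
- move=> c cg0; have /dist_rot ghf := fgh.
  have [d <-] := dist_cohom_exact ghf cg0.
  (* [hL] only concerns shifted morphisms, so [d : X[1] -> B] is rewritten as [d'[1]] with
     [d' : X -> B'], up to [B'[1]] being isomorphic to [B]. *)
  have [B' [w [w' [w'w ww']]]] := shift_esurj B.
  have [d' d'E] := shiftm_full (w' \oc d).
  rewrite -[d]comp1m -ww' -[w \oc w' \oc d]compA -d'E -compA hL ?compm0 //.
  move=> [s sd']; apply: BX1; apply: isomorphic_sym.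
  apply: (indecomposable_section (s := d)) => //.
    exists (shiftm s \oc w').
    by rewrite -compA -d'E -shiftm_comp sd' shiftm_id.
  by move=> /shift_zero_inv; exact: AR_dom_nonzero.
- by move=> c; rewrite -compA (dist_comp12 fgh) compm0.
- by move=> c; exact: dist_cohom_exact fgh.
- move=> c; have /dist_rot/dist_rot hfg := fgh.
  have [|d dE] := dist_cohom_exact (c := shiftm c) hfg.
    apply: hL => cS; apply: BX; apply: isomorphic_sym.
    by apply: (indecomposable_section cS) => //; exact: AR_dom_nonzero.
  have [d' d'E] := shiftm_full d.
  (* The sign compensates for [- shiftm f] in the rotated triangle. *)
  exists (- d'); apply: shiftm_inj.
  by rewrite compNm shiftmN shiftm_comp d'E -dE compmN.
Qed.

End AuslanderReiten.

(** * Additive functions on objects as homomorphisms on the split Grothendieck group *)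

Section AdditiveFunction.
Variable d : C -> int.
Hypothesis d_sum : forall A B X, is_sum2 A B X -> d X = d A + d B.

(** A zero object [N] is a biproduct of [N] with itself, so [d N = d N + d N]. *)
Lemma additive_fun_zero N : is_zero N -> d N = 0.
Proof.
move=> /zero_sum2/d_sum/eqP.
by rewrite -subr_eq0 opprD addNKr oppr_eq0 => /eqP.
Qed.

Lemma additive_fun_isomorphic X Y : isomorphic X Y -> d X = d Y.
Proof.
have [[N N0] _] := tcat_additive C.
by move=> /(isomorphic_sum2 N0)/d_sum ->; rewrite (additive_fun_zero N0) addr0.
Qed.

(** Universal property of [K0_split]: the linear extension of [d] to the free group kills the split
    relations. Compatibility with subtraction suffices for induction over a generated subgroup. *)
Lemma additive_fun_extension : exists phi : K0_split C -> int,
  {morph phi : x y / x - y} /\ forall X, phi (split_class X) = d X.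
Proof.
pose F : free_iso C -> int :=
  fglift (fun c : isoclass C => d (repr c : {classic C}) : int^o).
have FB : {morph F : x y / x - y} by exact: (@lift_is_additive _ _ int^o).
have F0 : F 0 = 0 by rewrite -(subrr 0) FB subrr.
have FD x y : F (x + y) = F x + F y.
  by rewrite -{1}[y]opprK FB -[- y]sub0r FB F0 sub0r opprK.
have F_class X : F (free_class X) = d X.
  rewrite /F /free_class liftU scale1r; apply: additive_fun_isomorphic.
  by apply/iso_classP; rewrite /iso_class reprK.
have F_split x : x \in subgroup_gen (split_relations (C := C)) -> F x = 0.
  apply: (subgroup_gen_ind (P := fun z => F z = 0)) => // [y z Fy Fz|_ [A [B [X [AB ->]]]]].
    by rewrite FB Fy Fz subrr.
  by rewrite FB FD !F_class (d_sum AB) subrr.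
have F_pi x y :
    x = y %[mod Quotient.quot (subgroup_gen (split_relations (C := C)))] ->
  F x = F y.
  move=> /eqP; rewrite -Quotient.idealrBE => /F_split.
  by rewrite FB => /eqP; rewrite subr_eq0 => /eqP.
(* By [F_pi], the value does not depend on the chosen representative. *)
exists (fun x => F (repr x)); split.
  by move=> x y; rewrite -FB; apply: F_pi; rewrite raddfB /= !reprK.
by move=> X; rewrite -F_class; apply: F_pi; rewrite reprK.
Qed.

End AdditiveFunction.

Lemma K0_proj_triangle X Y Z (f : hom X Y) (g : hom Y Z) (h : hom Z (shift X)) :
  dist f g h -> K0_proj C (split_class X + split_class Z - split_class Y) = 0.
Proof.
move=> fgh; rewrite -[RHS](raddf0 (K0_proj C)).
apply/eqP; rewrite /K0_proj -Quotient.idealrBE subr0.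
by apply: subgroup_gen_mem; exists X, Y, Z, f, g, h.
Qed.

(** Elements on which almost all [phi B] vanish form a subgroup; it contains the Auslander-Reiten
    relations, hence the kernel of [K0_proj]. Keeping [d] abstract covers [dim Hom(B, -)] and
    [dim Hom(-, B)] at once. *)
Lemma finite_support (d : C -> C -> nat) :
  (forall x : K0_split C,
     K0_proj C x = 0 -> x \in subgroup_gen (AR_relations C)) ->
  (forall B A A' X, is_sum2 A A' X -> d B X = (d B A + d B A')%N) ->
  (forall X Y Z (f : hom X Y) (g : hom Y Z) (h : hom Z (shift X)),
     AR_triangle f g h ->
     finite_set [set iso_class B | B in
       [set B | indecomposable B /\ d B Y <> (d B X + d B Z)%N]]) ->
  forall A, finite_set [set iso_class B | B in
    [set B | indecomposable B /\ d B A <> 0%N]].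
Proof.
move=> kerP d_sum d_AR A.
have /choice[phi phiP] : forall B, exists phi : K0_split C -> int,
    {morph phi : x y / x - y} /\ forall X, phi (split_class X) = (d B X)%:Z.
  move=> B; apply: additive_fun_extension => A1 A2 X /(d_sum B) ->.
  exact: PoszD.
have phiB B := (phiP B).1; have phi_class B := (phiP B).2.
have phi0 B : phi B 0 = 0 by rewrite -(subrr 0) phiB subrr.
have phiD B x y : phi B (x + y) = phi B x + phi B y.
  by rewrite -{1}[y]opprK phiB -[- y]sub0r phiB phi0 sub0r opprK.
have fin x : x \in subgroup_gen (AR_relations C) ->
    finite_set [set iso_class B | B in
      [set B | indecomposable B /\ phi B x <> 0]].
  apply: (subgroup_gen_ind (P := fun x => finite_set [set iso_class B | B in
      [set B | indecomposable B /\ phi B x <> 0]])) => [|y z yfin zfin|].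
  - by rewrite (_ : mkset _ = set0) ?image_set0 // -subset0 => B [_].
  - have := conj yfin zfin; rewrite -finite_setU; apply: sub_finite_set.
    move=> _ [B [Bi Bx] <-]; have [y0|y0] := pselect (phi B y = 0).
      right; exists B => //; split=> // z0.
      by apply: Bx; rewrite phiB y0 z0 subrr.
    by left; exists B.
  - move=> _ [X [Y [Z [f [g [h [AR ->]]]]]]].
    apply: sub_finite_set (d_AR _ _ _ _ _ _ AR).
    move=> _ [B [Bi Bx] <-]; exists B => //; split=> // dY; apply: Bx.
    by rewrite phiB phiD !phi_class dY PoszD subrr.
have [[N N0] _] := tcat_additive C.
(* Rotating [A -> A -> 0] gives [A -> 0 -> A[1]]. As [d] takes values in [nat], the vanishing of
   [d B A + d B (shift A)] forces [d B A = 0]. *)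
have /dist_rot/K0_proj_triangle/kerP/fin := dist_id A N0.
apply: sub_finite_set => _ [B [Bi BA] <-]; exists B => //; split=> //.
have dN : d B N = 0%N.
  have /(d_sum B)/eqP := zero_sum2 N0.
  by rewrite -{1}[d B N]addn0 eqn_add2l eq_sym => /eqP.
rewrite phiB phiD !phi_class dN subr0 -PoszD => -[] /eqP.
by rewrite addn_eq0 => /andP[/eqP].
Qed.

(** * Local finiteness *)

Section LocalFiniteness.
Hypothesis kerP : forall x : K0_split C,
  K0_proj C x = 0 -> x \in subgroup_gen (AR_relations C).

Lemma finite_hom_to A :
  finite_set [set iso_class B | B in
    [set B | indecomposable B /\ exists f : hom B A, f <> 0]].
Proof.
have AR_finite X Y Z (f : hom X Y) (g : hom Y Z) (h : hom Z (shift X)) :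
    AR_triangle f g h -> finite_set [set iso_class B | B in
      [set B | indecomposable B /\ hdim B Y <> (hdim B X + hdim B Z)%N]].
  move=> AR; have [Z' Z'Z] := shift_esurj Z.
  (* By [AR_hdimr], additivity can fail only for [B] in the class of [Z] or of [Z[-1]]. *)
  apply: sub_finite_set (finite_set2 (iso_class Z) (iso_class Z')).
  move=> _ [B [Bi BY] <-]; apply: contrapT => /not_orP[BZ BZ'].
  by apply: BY; apply: (AR_hdimr AR Bi Z'Z) => /iso_classP.
have := finite_support kerP (@hdim_sumr _ C) AR_finite A.
apply: sub_finite_set => _ [B [Bi [f f0]] <-]; exists B => //; split=> // d0.
by apply: f0; exact: hdim_eq0.
Qed.

Lemma finite_hom_from A :
  finite_set [set iso_class B | B in
    [set B | indecomposable B /\ exists f : hom A B, f <> 0]].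
Proof.
have AR_finite X Y Z (f : hom X Y) (g : hom Y Z) (h : hom Z (shift X)) :
    AR_triangle f g h -> finite_set [set iso_class B | B in
      [set B | indecomposable B /\ hdim Y B <> (hdim X B + hdim Z B)%N]].
  move=> AR.
  (* Dually, by [AR_hdiml], the only possible exceptions are the classes of [X] and [X[1]]. *)
  apply: sub_finite_set (finite_set2 (iso_class X) (iso_class (shift X))).
  move=> _ [B [Bi BY] <-]; apply: contrapT => /not_orP[BX BX1].
  by apply: BY; apply: (AR_hdiml AR Bi) => /iso_classP.
have := finite_support (d := fun B X => hdim X B) kerP
  (@hdim_suml _ C) AR_finite A.
apply: sub_finite_set => _ [B [Bi [f f0]] <-]; exists B => //; split=> // d0.
by apply: f0; exact: hdim_eq0.
Qed.

End LocalFiniteness.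

(** * Finiteness of [Ind C] in the presence of a cluster tilting object *)

Lemma add_closure_hom0 (T0 T1 X : C) :
  (forall f : hom T0 X, f = 0) -> add_closure T0 T1 ->
  forall f : hom T1 X, f = 0.
Proof.
move=> T0X [n [Y [[i [p [_ _ ip]]] [W [i1 [_ [p1 [_ [e1 _ _ _ _]]]]]]]]] f.
rewrite -[f]compm1 -e1 compA (_ : f \oc p1 = 0) ?comp0m //.
rewrite -[f \oc p1]compm1 -ip comp_sumr big1 // => k _.
by rewrite compA (T0X (f \oc p1 \oc i k)) comp0m.
Qed.

Lemma cluster_tilting_Ind_finite (T0 : C) :
  cluster_tilting_object T0 ->
  finite_set [set iso_class B | B in
    [set B | indecomposable B /\ exists f : hom T0 B, f <> 0]] ->
  finite_set (Ind C).
Proof.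
set S := (X in finite_set X) => -[_ _ _ T0E _] Sfin.
pose sh (c : isoclass C) := iso_class (shift (repr c : {classic C}) : C).
(* It remains to show that every indecomposable class lies in [S] or in its shift. *)
have : finite_set (S `|` sh @` S).
  by rewrite finite_setU; split=> //; exact: finite_image.
apply: sub_finite_set => _ [X Xi <-].
have [[f f0]|noT0X] := pselect (exists f : hom T0 X, f <> 0).
  by left; exists X => //; split=> //; exists f.
right; have T0X (f : hom T0 X) : f = 0.
  by apply: contrapT => f0; apply: noT0X; exists f.
have [X' X'X] := shift_esurj X; have X'i := shift_indecomposable_inv X'X Xi.
have T_X' : add_closure T0 X'.
  (* Vanishing of [Hom(T0, X)] passes to all of [add_closure T0], and [X] is isomorphic to [X'[1]],
     so the Ext-vanishing description of [add_closure T0] applies to [X']. *)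
  rewrite T0E => T1 f T1T; have [w [w' [w'w _]]] := X'X.
  by rewrite -[f]comp1m -w'w -compA (add_closure_hom0 T0X T1T (w \oc f)) compm0.
exists (iso_class X').
  exists X' => //; split=> //; apply: contrapT => noT0X'.
  (* If all maps [T0 -> X'] vanished, so would [idm X'], because [X'] lies in [add_closure T0]. *)
  apply: (X'i.1); apply: (add_closure_hom0 _ T_X') => f.
  by apply: contrapT => f0; apply: noT0X'; exists f.
transitivity (iso_class (shift X')); apply/iso_classP => //.
by apply/shift_isomorphic/iso_classP; rewrite {1}/iso_class reprK.
Qed.

End Triangulated.

Theorem theorem4p9 (K : fieldType) (C : triCat K)
    (C_nonzero : exists X : C, ~ is_zero X)
    (C_KS : krull_schmidt C)
    (T : set C) (T_ct : cluster_tilting T)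
    (ker_psi : forall x : K0_split C,
       K0_proj C x = 0 <-> x \in subgroup_gen (AR_relations C)) :
  locally_finite C /\
  (forall T0 : C, cluster_tilting_object T0 -> T = add_closure T0 ->
     finite_set (Ind C)).
Proof.
have kerP x := (ker_psi x).1.
split.
  by move=> A _; split; [exact: finite_hom_from | exact: finite_hom_to].
move=> T0 T0_ct _; apply: (cluster_tilting_Ind_finite T0_ct).
exact: finite_hom_from.
Qed.
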